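(* Let $d \geq 1$ be an integer, let $U \subseteq \mathbb{R}^d$ be a connected open set (possibly $U = \mathbb{R}^d$), and let $A : U \to \mathbb{R}$ be a real analytic function. If $A$ is not identically zero on $U$, then its zero set $$F(A) := \{x \in U : A(x) = 0\}$$ has zero measure, i.e. $\operatorname{mes}_d F(A) = 0$.
   Context: $\operatorname{mes}_d$ denotes $d$-dimensional Lebesgue measure on $\mathbb{R}^d$. A set $C \subseteq \mathbb{R}^d$ has $\operatorname{mes}_d C = 0$ if for every $\epsilon > 0$ there is a (countable) system of balls $B(y,\delta(y))$, $y \in Y$, in $\mathbb{R}^d$ covering $C$ with $\sum_{y \in Y} \delta(y)^d < \epsilon$. *)

(* Defs.v *)
From mathcomp Require Import all_boot all_order all_algebra finmap.
From mathcomp Require Import all_classical all_reals all_analysis.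
From mathcomp.analysis Require Import showcase.summability.

Set Implicit Arguments.
Unset Strict Implicit.
Unset Printing Implicit Defensive.

Import Order.TTheory GRing.Theory Num.Theory numFieldNormedType.Exports.

Local Open Scope classical_set_scope.
Local Open Scope ring_scope.

(* The library norm on 'rV[R]_d is the sup norm, hence an explicit Euclidean
   ball. *)
Definition eball (R : realType) (d : nat) (y : 'rV[R]_d) (r : R)
    : set 'rV[R]_d :=
  [set x | Num.sqrt (\sum_(i < d) (x 0 i - y 0 i) ^+ 2) < r].

Definition mes_zero (R : realType) (d : nat) (C : set 'rV[R]_d) : Prop :=
  forall e : R, 0 < e ->
  exists (Y : set 'rV[R]_d) (delta : 'rV[R]_d -> R),
    [/\ countable Y,
        (forall y, Y y -> 0 < delta y),
        C `<=` \bigcup_(y in Y) eball y (delta y) &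
        (\esum_(y in Y) (delta y ^+ d)%:E < e%:E)%E].

Definition monomial (R : realType) (d : nat) (a : {ffun 'I_d -> nat})
    (x : 'rV[R]_d) : R :=
  \prod_(i < d) x 0 i ^+ a i.

(* The filter [totally] of finite sets of multi-indices ordered by inclusion
   expresses unconditional (equivalently, absolute) convergence of the power
   series, with no order chosen on the multi-indices. *)
Definition real_analytic_at (R : realType) (d : nat) (f : 'rV[R]_d -> R)
    (p : 'rV[R]_d) : Prop :=
  exists c : {ffun 'I_d -> nat} -> R,
    \forall x \near p,
      (fun J : {fset {ffun 'I_d -> nat}} =>
         \sum_(a <- J) c a * monomial a (x - p)) @ totally --> f x.

(* Meant for open U: the condition then depends only on the restriction of f
   to U. *)
Definition real_analytic_on (R : realType) (d : nat) (U : set 'rV[R]_d)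
    (f : 'rV[R]_d -> R) : Prop :=
  forall p, U p -> real_analytic_at f p.

(* Main.v *)
Require Import Defs.
From mathcomp Require Import all_boot all_order all_algebra finmap.
From mathcomp Require Import all_classical all_reals all_analysis.
From mathcomp.analysis Require Import showcase.summability.
From mathcomp Require Import zify ring lra.

(** The zero set is controlled by walking down the partial derivatives, with
    sup-norm boxes and explicit covers.

    Let [f] be the sum near [p] of a power series with a nonzero coefficient
    [c a].  The derivative of [f] of multi-order [a] at [p] is [c a] times
    factorials, so it has no zero near [p].  Removing one derivative at a time
    preserves smallness of the zero set: if [g'] is the partial derivative of
    [g] along axis [i], then
      {g = 0}  is contained in  {g' = 0}  union  {g = 0, g' <> 0}.
    The first set is small by induction.  On the second one [g] is strictly
    monotone along axis [i] and Lipschitz in the other coordinates, so locally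
    the set is part of a Lipschitz graph over a coordinate hyperplane, and such a
    graph is covered by [N ^ (d - 1)] balls of radius [O(1 / N)]
    ([mes_zero_Lipschitz_graph], [mes_zero_regular_zeros],
    [thin_zeros_partial], [thin_zeros_jet]).  The same descent shows that [f]
    vanishes on no nonempty open set near [p], because [g = 0] on an open set
    forces [g' = 0] there.

    So each point of [U] either has a neighborhood on which [A] vanishes, or a
    ball in which the zeros of [A] are null and have empty interior
    ([analytic_thin_zeros]).  The points of the first kind form a relatively
    clopen subset of [U], which is empty since [A] is not identically zero;
    hence the zero set is locally null, and therefore null because countably
    many rational boxes suffice ([mes_zero_local]).

    That the series may be differentiated term by term is a consequence of
    estimates on the derived monomials, of first order (Lipschitz) and of
    second order along an axis (Taylor): these are uniform over the finite
    partial sums, so they pass to the unconditional limit. *)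

Import Order.TTheory GRing.Theory Num.Theory numFieldNormedType.Exports.

Set Implicit Arguments.
Unset Strict Implicit.
Unset Printing Implicit Defensive.

Local Open Scope classical_set_scope.
Local Open Scope ring_scope.

(** * Null sets *)

Lemma esum_subset (R : realType) (T : choiceType) (A B : set T)
    (a : T -> \bar R) :
  A `<=` B -> (\esum_(i in A) a i <= \esum_(i in B) a i)%E.
Proof.
move=> AB; apply: le_ereal_sup => _ [X [finX XA] <-].
by exists X => //; split => //; exact: subset_trans XA AB.
Qed.

Lemma esum_scale_le (R : realType) (T : choiceType) (A : set T)
    (k : R) (a : T -> R) : 0 <= k -> (forall i, 0 <= a i) ->
  (\esum_(i in A) (k * a i)%:E <= k%:E * \esum_(i in A) (a i)%:E)%E.
Proof.
move=> k0 a0; apply: ge_ereal_sup => _ [X XA <-].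
under eq_fsbigr do rewrite EFinM.
rewrite -ge0_mule_fsumr//.
apply: lee_wpmul2l; first by rewrite lee_fin.
by apply: ereal_sup_ubound; exists X.
Qed.

(** [mes_zero] attaches a single radius to each center.  A cover indexed by an
    arbitrary type may repeat centers with different radii; keeping for each
    center twice one nearly maximal radius costs only a factor [2 ^+ d].
    Covers with repetitions are what unions and grids produce. *)
Lemma mes_zero_of_cover (R : realType) (d : nat) (C : set 'rV[R]_d) :
    (0 < d)%N ->
    (forall e : R, 0 < e ->
      exists (T : choiceType) (D : set T) (y : T -> 'rV[R]_d) (r : T -> R),
      [/\ countable D, (forall t, D t -> 0 < r t),
          C `<=` \bigcup_(t in D) eball (y t) (r t) &
          (\esum_(t in D) (r t ^+ d)%:E <= e%:E)%E]) ->
  mes_zero C.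
Proof.
move=> d0 cov e e0.
pose e' := Num.min 1 (e / 2 ^+ d.+1).
have pow0 n : 0 < 2 ^+ n :> R by rewrite exprn_gt0.
have e'0 : 0 < e' by rewrite lt_min ltr01 divr_gt0.
have [T [D [y [r [cD r0 CD sumD]]]]] := cov e' e'0.
have [[t0 Dt0]|D0] := pselect (exists t, D t); last first.
  exists set0, (fun=> 0); split => //.
    by move=> x /CD[t Dt]; case: D0; exists t.
  by rewrite esum_set0 lte_fin.
have r1 t : D t -> r t <= 1.
  move=> Dt; rewrite leNgt; apply/negP => rt1.
  have : ((r t ^+ d)%:E <= e'%:E)%E.
    apply: le_trans sumD; rewrite -(@esum_set1 _ _ t (fun t => (r t ^+ d)%:E)).
      by apply: esum_subset => _ ->.
    by rewrite lee_fin exprn_ge0// ltW// r0.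
  rewrite lee_fin leNgt => /negP; apply.
  rewrite (@le_lt_trans _ _ 1)//; first by rewrite ge_min lexx.
  by rewrite exprn_egt1// -lt0n.
pose Y := y @` D.
(* The supremum of the radii at a center need not be attained, whence an index
   whose radius is at least half of it. *)
have rep v : exists t, Y v ->
    [/\ D t, y t = v & forall s, D s -> y s = v -> r s <= 2 * r t].
  have [[t Dt yt]|nYv] := pselect (Y v); last by exists t0.
  pose S := [set r s | s in [set s | D s /\ y s = v]].
  have supS : has_sup S.
    split; first by exists (r t); exists t.
    by exists 1 => _ [s [Ds _] <-]; exact: r1.
  have St : sup S >= r t by apply: sup_upper_bound => //; exists t.
  have S0 : 0 < sup S by apply: lt_le_trans St; exact: r0.
  have [_ [s [Ds ys] <-] lts] := sup_adherent (divr_gt0 S0 (ltr0Sn _ 1)) supS.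
  exists s => _; split => // u Du yu.
  have : r u <= sup S by apply: sup_upper_bound => //; exists u.
  by lra.
have [n nP] := choice rep.
exists Y, (fun v => 2 * r (n v)); split.
- exact: card_le_trans (card_image_le _ _) cD.
- by move=> v /nP[Dn _ _]; rewrite mulr_gt0// r0.
- move=> x /CD[t Dt xt]; exists (y t); first by exists t.
  have Yt : Y (y t) by exists t.
  have [_ _ /(_ _ Dt erefl)] := nP _ Yt.
  exact: lt_le_trans.
- apply: (@le_lt_trans _ _ ((2 ^+ d)%:E * e'%:E)%E).
    have abs0 v : 0 <= `|r (n v)| ^+ d by exact: exprn_ge0.
    rewrite (eq_esum (b := fun v => (2 ^+ d * `|r (n v)| ^+ d)%:E)); last first.
      by move=> v /nP[/r0 r00 _ _]; rewrite exprMn gtr0_norm.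
    apply: le_trans (esum_scale_le Y (ltW (pow0 d)) abs0) _.
    apply: lee_wpmul2l; first by rewrite lee_fin ltW.
    rewrite -(@esum_image _ _ _ Y n (fun t => (`|r t| ^+ d)%:E)); last first.
      move=> u v; rewrite !inE => /nP[_ yu _] /nP[_ yv _] nuv.
      by rewrite -yu -yv nuv.
    apply: le_trans sumD.
    rewrite [leRHS](eq_esum (b := fun t => (`|r t| ^+ d)%:E)); last first.
      by move=> t /r0 rt; rewrite gtr0_norm.
    by apply: esum_subset => _ [v /nP[Dn _ _] <-].
  rewrite -EFinM lte_fin.
  apply: (@le_lt_trans _ _ (2 ^+ d * (e / 2 ^+ d.+1))).
    by rewrite ler_pM2l// ge_min lexx orbT.
  rewrite (_ : _ * _ = e / 2); first by lra.
  by rewrite exprS; field; rewrite gt_eqF.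
Qed.

Lemma mes_zero_subset (R : realType) (d : nat) (B C : set 'rV[R]_d) :
  B `<=` C -> mes_zero C -> mes_zero B.
Proof.
move=> BC C0 e /C0[Y [r [cY r0 CY sY]]]; exists Y, r; split => //.
exact: subset_trans CY.
Qed.

Lemma mes_zero_bigcup (R : realType) (d : nat) (C : nat -> set 'rV[R]_d) :
  (0 < d)%N -> (forall n, mes_zero (C n)) -> mes_zero (\bigcup_n C n).
Proof.
move=> d0 C0; apply: mes_zero_of_cover => // e e0.
have en n : 0 < e / (2 ^ n.+1)%:R by rewrite divr_gt0// ltr0n expn_gt0.
have /choice[Y /choice[r Yr]] := fun n => C0 n _ (en n).
exists (nat * 'rV[R]_d)%type, ([set: nat] `*`` Y), snd, (fun p => r p.1 p.2).
split.
- by apply: countableXR => [|n _]; [exact: countableP|have [] := Yr n].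
- by move=> [n v] [_ /=]; have [_ + _ _] := Yr n; exact.
- move=> x [n _ Cnx]; have [_ _ /(_ _ Cnx)[v Yv xv] _] := Yr n.
  by exists (n, v).
- rewrite -(@esum_esum _ _ _ _ _ (fun n v => (r n v ^+ d)%:E)); last first.
    move=> n v _ Yv; rewrite lee_fin exprn_ge0// ltW//.
    by have [_ + _ _] := Yr n; exact.
  apply: le_trans (epsilon_trick0 xpredT (ltW e0)).
  rewrite nneseries_esum => [|n _]; last by rewrite lee_fin ltW.
  rewrite set_true; apply: le_esum => n _.
  by have [_ _ _ /ltW] := Yr n.
Qed.

Lemma mes_zero_affine (R : realType) (d : nat) (p : 'rV[R]_d) (s : R)
    (C : set 'rV[R]_d) : (0 < d)%N -> 0 < s ->
  mes_zero C -> mes_zero [set p + s *: z | z in C].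
Proof.
move=> d0 s0 C0; apply: mes_zero_of_cover => // e e0.
have sd0 : 0 < s ^+ d by rewrite exprn_gt0.
have [Y [r [cY r0 CY sY]]] := C0 (e / s ^+ d) (divr_gt0 e0 sd0).
exists 'rV[R]_d, Y, (fun y => p + s *: y), (fun y => s * `|r y|); split => //.
- by move=> y /r0 ry; rewrite mulr_gt0// normr_gt0 gt_eqF.
- move=> _ [z /CY[y Yy zy] <-]; exists y => //.
  rewrite /eball/= (gtr0_norm (r0 _ Yy)).
  under eq_bigr do rewrite !mxE opprD addrACA subrr add0r -mulrBr exprMn.
  rewrite -mulr_sumr sqrtrM ?sqr_ge0// sqrtr_sqr gtr0_norm// ltr_pM2l//.
- under eq_esum do rewrite exprMn.
  apply: le_trans (esum_scale_le _ (ltW sd0) _) _.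
    by move=> y; exact: exprn_ge0.
  rewrite (eq_esum (b := fun y => (r y ^+ d)%:E)); last first.
    by move=> y /r0 ry; rewrite gtr0_norm.
  apply: (@le_trans _ _ ((s ^+ d)%:E * (e / s ^+ d)%:E)%E).
    by apply: lee_wpmul2l; [rewrite lee_fin ltW|exact: ltW].
  by rewrite -EFinM lee_fin mulrC divfK// gt_eqF.
Qed.

Lemma ball_rowE (R : realType) (d : nat) (p x : 'rV[R]_d) (r : R) : 0 < r ->
  ball p r x <-> forall i, `|p 0 i - x 0 i| < r.
Proof.
move=> r0; split=> [[_ px] i|px]; first exact: px.
by split=> // i j; rewrite ord1; exact: px.
Qed.

Lemma mes_zero0 (R : realType) (d : nat) : mes_zero (@set0 'rV[R]_d).
Proof.
by move=> e e0; exists set0, (fun=> 0); split => //; rewrite esum_set0 lte_fin.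
Qed.

(** Balls with rational center and radius [1 / k.+1] are countably many and form
    a basis, so those that meet [Z] in a null set already cover [Z]. *)
Lemma mes_zero_local (R : realType) (d : nat) (Z : set 'rV[R]_d) : (0 < d)%N ->
    (forall p, Z p -> exists2 r : R, 0 < r & mes_zero (Z `&` ball p r)) ->
  mes_zero Z.
Proof.
move=> d0 Zloc.
pose B (c : 'rV[rat]_d * nat) : set 'rV[R]_d :=
  ball (map_mx (@ratr R) c.1) c.2.+1%:R^-1.
pose C n : set 'rV[R]_d := if choice.unpickle n is Some c then
  if `[< mes_zero (Z `&` B c) >] then Z `&` B c else set0 else set0.
apply: (@mes_zero_subset _ _ _ (\bigcup_n C n)); last first.
  apply: mes_zero_bigcup => // n; rewrite /C.
  case: choice.unpickle => [c|]; last exact: mes_zero0.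
  by case: asboolP => // _; exact: mes_zero0.
move=> p Zp; have [r r0 Zr] := Zloc p Zp.
pose k := Num.trunc (2 / r).
have k0 : 0 < k.+1%:R^-1 :> R by rewrite invr_gt0.
have kr : k.+1%:R^-1 < r / 2.
  by rewrite invf_plt ?posrE// ?divr_gt0// invf_div truncnS_gt.
have near_rat i : exists u : rat, `|ratr u - p 0 i| < k.+1%:R^-1 :> R.
  have [|u] := @rat_in_itvoo R (p 0 i - k.+1%:R^-1) (p 0 i + k.+1%:R^-1).
    by rewrite ltrBlDr -addrA ltrDl addr_gt0.
  by rewrite in_itv/= => pu; exists u; rewrite ltr_distl.
have [q qp] := choice near_rat.
pose c := (\row_i q i, k).
have Bcp : B c p.
  by rewrite /B; apply/ball_rowE => // i; rewrite !mxE; exact: qp.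
have subB : Z `&` B c `<=` Z `&` ball p r.
  move=> x [Zx Bx]; split => //.
  apply: (@le_ball _ _ _ (k.+1%:R^-1 + k.+1%:R^-1)).
    by rewrite [leRHS]splitr lerD// ltW.
  by apply: ball_triangle Bx; exact/ball_sym.
exists (choice.pickle c) => //; rewrite /C choice.pickleK.
case: asboolP => // -[].
exact: mes_zero_subset Zr.
Qed.

Lemma mes_zero_bigcup2 (R : realType) (d : nat) (B C : set 'rV[R]_d) :
  (0 < d)%N -> mes_zero B -> mes_zero C -> mes_zero (B `|` C).
Proof.
move=> d0 B0 C0; rewrite -bigcup2E; apply: mes_zero_bigcup => //.
by case=> [|[|n]] //=; exact: mes_zero0.
Qed.

Lemma esum_const_le (R : realType) (T : finType) (D : set T) (c : R) : 0 <= c ->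
  (\esum_(i in D) c%:E <= (#|T|%:R * c)%:E)%E.
Proof.
move=> c0; apply: ge_ereal_sup => _ [X [finX _] <-].
rewrite fsbig_finite//= sumEFin lee_fin big_const_seq iter_addr_0 count_predT.
rewrite -[leLHS]mulr_natl ler_wpM2r// ler_nat -(card_uniqP (fset_uniq _)).
exact: max_card.
Qed.

(** Cut the [d - 1] coordinates other than [i] into [N] slices each.  Two points
    of [S] in the same column differ by at most [2 r / N] in these coordinates,
    hence by [O(1 / N)] in coordinate [i] as well: one ball of radius [c / N]
    per column covers [S], and the cost is [N ^ (d - 1) * (c / N) ^ d], that is
    [c ^ d / N]. *)
Lemma mes_zero_Lipschitz_graph (R : realType) (d : nat) (i : 'I_d)
    (S : set 'rV[R]_d) (q : 'rV[R]_d) (r K : R) : 0 < r -> 0 <= K ->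
    S `<=` ball q r ->
    (forall x y h, S x -> S y -> 0 <= h ->
       (forall j, j != i -> `|x 0 j - y 0 j| <= h) ->
       `|x 0 i - y 0 i| <= K * h) ->
  mes_zero S.
Proof.
case: d i S q => [[]//|n] i S q r0 K0 Sball Slip.
apply: mes_zero_of_cover => // e e0.
pose c := n.+1%:R * ((K + 2) * (2 * r)).
have c0 : 0 < c by rewrite !mulr_gt0//; lra.
pose N := (Num.trunc (c ^+ n.+1 / e)).+1.
have N0 : 0 < N%:R :> R by rewrite ltr0n.
pose code (x : 'rV[R]_n.+1) : {ffun 'I_n -> 'I_N} := [ffun k =>
  inord (Num.trunc ((x 0 (lift i k) - q 0 (lift i k) + r) / (2 * r) * N%:R))].
have code_near x y j : S x -> S y -> code x = code y -> j != i ->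
    `|x 0 j - y 0 j| <= 2 * r / N%:R.
  move=> Sx Sy /ffunP xy; case: (unliftP i j) => [k ->|-> /eqP//] _.
  have := xy k; rewrite !ffunE => /(congr1 val).
  have itv z : S z ->
      0 <= (z 0 (lift i k) - q 0 (lift i k) + r) / (2 * r) * N%:R < N%:R.
    move=> /Sball /ball_rowE -/(_ r0 (lift i k)); rewrite ltr_norml => zq.
    rewrite mulr_ge0 ?ler0n ?divr_ge0//=; [|lra|lra].
    rewrite gtr_pMl// ltr_pdivrMr ?mulr_gt0//; lra.
  have /andP[x0 xN] := itv x Sx; have /andP[y0 yN] := itv y Sy.
  rewrite /= !inordK ?truncn_lt_nat// => txy.
  have /andP[x1 x2] := truncn_itv x0; have /andP[y1 y2] := truncn_itv y0.
  rewrite txy in x1 x2; move: x1 x2 y1 y2.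
  set a := x _ _; set b := y _ _; set m := q _ _ => x1 x2 y1 y2.
  have : `|(a - m + r) / (2 * r) * N%:R - (b - m + r) / (2 * r) * N%:R| <= 1.
    by rewrite ler_norml; lra.
  have -> : (a - m + r) / (2 * r) * N%:R - (b - m + r) / (2 * r) * N%:R =
      (a - b) * (N%:R / (2 * r)).
    by field; rewrite gt_eqF.
  have Nr : 0 < N%:R / (2 * r) by rewrite divr_gt0// mulr_gt0.
  by rewrite normrM (gtr0_norm Nr) -ler_pdivlMr// div1r invf_div.
pose D := code @` S.
have /choice[z zP] : forall f, exists z, D f -> S z /\ code z = f.
  move=> f; have [[z Sz zf]|nDf] := pselect (D f); first by exists z.
  by exists 0.
exists {ffun 'I_n -> 'I_N}, D, z, (fun=> c / N%:R); split.
- exact: countableP.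
- by move=> _ _; rewrite divr_gt0.
- move=> x Sx; exists (code x); first by exists x.
  have [Sz zx] : S (z (code x)) /\ code (z (code x)) = code x.
    by apply: zP; exists x.
  set h := 2 * r / N%:R.
  have h0 : 0 < h by rewrite divr_gt0// mulr_gt0.
  have near_z j : `|x 0 j - z (code x) 0 j| <= (K + 1) * h.
    have [->|ji] := eqVneq j i.
      apply: (@le_trans _ _ (K * h)); last by rewrite ler_pM2r//; lra.
      apply: Slip => //; first exact: ltW.
      by move=> k ki; apply: code_near.
    apply: le_trans (code_near _ _ _ Sx Sz (esym zx) ji) _.
    by apply: ler_peMl; [exact: ltW|lra].
  rewrite /eball/=.
  have -> : c / N%:R = n.+1%:R * ((K + 2) * h).
    by rewrite /c /h; field; rewrite gt_eqF.
  have K1h : 0 < (K + 1) * h by rewrite mulr_gt0//; lra.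
  have K2h : 0 < (K + 2) * h by rewrite mulr_gt0//; lra.
  have b0 : 0 < n.+1%:R * ((K + 2) * h) by rewrite mulr_gt0.
  rewrite -[ltRHS](gtr0_norm b0) -sqrtr_sqr ltr_sqrt ?exprn_gt0//.
  apply: (@le_lt_trans _ _ (n.+1%:R * ((K + 1) * h) ^+ 2)).
    have -> : n.+1%:R * ((K + 1) * h) ^+ 2 = \sum_(j < n.+1) ((K + 1) * h) ^+ 2.
      by rewrite sumr_const card_ord mulr_natl.
    apply: ler_sum => j _; rewrite -[leLHS]real_normK ?num_real//.
    by rewrite lerXn2r// ?nnegrE// ltW.
  (* The Euclidean norm is at most [sqrt (n + 1)] times the sup norm; the
     radius [c / N] affords the factor [n + 1]. *)
  rewrite [ltRHS]exprMn.
  apply: (@lt_le_trans _ _ (n.+1%:R * ((K + 2) * h) ^+ 2)).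
    rewrite ltr_pM2l// ltrXn2r// ?nnegrE; try exact: ltW.
    by rewrite ltr_pM2r//; lra.
  rewrite ler_pM2r; last by rewrite exprn_gt0.
  by rewrite expr2 ler_peMl// ler1n.
- apply: le_trans (esum_const_le _ _) _.
    by rewrite exprn_ge0// divr_ge0// ltW.
  rewrite lee_fin card_ffun !card_ord natrX.
  rewrite (_ : _ * _ = c ^+ n.+1 / N%:R).
    by rewrite ler_pdivrMr// mulrC -ler_pdivrMr// ltW// truncnS_gt.
  rewrite expr_div_n [N%:R ^+ n.+1]exprS; field.
  by rewrite gt_eqF//= expf_neq0// gt_eqF.
Qed.

(** * Zeros of a function and of its partial derivatives *)

Lemma ball_row_open (R : realType) (d : nat) (p x : 'rV[R]_d) (r : R) :
  0 < r -> ball p r x -> exists2 s : R, 0 < s & ball x s `<=` ball p r.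
Proof.
move=> r0 /ball_rowE -/(_ r0) px.
pose m := \big[Num.max/0]_i `|p 0 i - x 0 i|.
have mr : m < r by apply: bigmax_lt.
exists (r - m); first by rewrite subr_gt0.
move=> y /ball_rowE; rewrite subr_gt0 => /(_ mr) xy.
apply/ball_rowE => // i; have := xy i.
have : `|p 0 i - x 0 i| <= m by rewrite /m; exact: le_bigmax.
by have := ler_distD (x 0 i) (p 0 i) (y 0 i); lra.
Qed.

Definition unit_box (R : realType) (d : nat) (x : 'rV[R]_d) :=
  forall j, `|x 0 j| <= 1.

Definition lipschitz_box (R : realType) (d : nat) (L : R) (g : 'rV[R]_d -> R) :=
  forall x y h, unit_box x -> unit_box y -> 0 <= h ->
    (forall j, `|x 0 j - y 0 j| <= h) -> `|g x - g y| <= L * h.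

(** A quantitative form, uniform on the unit box, of: [g'] is the partial
    derivative of [g] along axis [i]. *)
Definition partial_box (R : realType) (d : nat) (L : R) (i : 'I_d)
    (g g' : 'rV[R]_d -> R) :=
  forall x y, unit_box x -> unit_box y -> (forall j, j != i -> y 0 j = x 0 j) ->
    `|g y - g x - g' x * (y 0 i - x 0 i)| <= L * (y 0 i - x 0 i) ^+ 2.

(** Nullity serves the conclusion, and the absence of interior serves the
    identity theorem.  Carrying both through the same induction avoids proving
    that a nonempty open set is not null. *)
Definition thin_zeros (R : realType) (d : nat) (r : R) (g : 'rV[R]_d -> R) :=
  mes_zero [set x | ball 0 r x /\ g x = 0] /\
  forall p, ball 0 r p -> ~ (\forall x \near p, g x = 0).

Lemma ball01_unit_box (R : realType) (d : nat) (x : 'rV[R]_d) :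
  ball 0 1 x -> unit_box x.
Proof.
move=> /ball_rowE -/(_ ltr01) x1 j; have := x1 j.
by rewrite mxE sub0r normrN => /ltW.
Qed.

(** Near a point where [g'] does not vanish, [g] varies along axis [i] at a rate
    bounded below, while it is Lipschitz in the other coordinates.  Comparing
    two zeros [x] and [z] through the point [y] that has coordinate [i] of [z]
    and the other coordinates of [x] gives the Lipschitz graph condition. *)
Lemma mes_zero_regular_zeros (R : realType) (d : nat) (L : R) (i : 'I_d)
    (g g' : 'rV[R]_d -> R) :
    0 <= L -> lipschitz_box L g -> lipschitz_box L g' -> partial_box L i g g' ->
  mes_zero [set x | [/\ ball 0 1 x, g x = 0 & g' x != 0]].
Proof.
move=> L0 Lg Lg' dg.
have d0 : (0 < d)%N by case: d i {g g' Lg Lg' dg} => [[]|].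
apply: mes_zero_local => // p [p1 _ gp].
pose k : R := `|g' p|; have k0 : 0 < k by rewrite normr_gt0.
have [s s0 sp] := ball_row_open ltr01 p1.
(* On [ball p r], [g'] stays above [3 k / 4] in norm and the quadratic Taylor
   error is at most half of [k] times the displacement, which leaves a rate of
   at least [k / 4]. *)
pose r : R := Num.min s (k / (4 * (L + 1))).
have r0 : 0 < r by rewrite lt_min s0 divr_gt0//; lra.
have rs : r <= s by rewrite ge_min lexx.
have Lr : L * r <= k / 4.
  have : r * (4 * (L + 1)) <= k.
    rewrite -ler_pdivlMr; last by lra.
    by rewrite /r ge_min lexx orbT.
  by lra.
have pbox x : ball p r x -> unit_box x.
  by move=> /(le_ball rs)/sp/ball01_unit_box.
have Lk0 : 0 <= 4 * L / k by rewrite divr_ge0// ?mulr_ge0// ltW.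
exists r => //; apply: (mes_zero_Lipschitz_graph (i := i) (q := p) r0 Lk0).
  by move=> x [_ px].
move=> x z h [[x1 gx _] px] [[z1 gz _] pz] h0 xz.
pose y := \row_j (if j == i then z 0 j else x 0 j).
have yx j : j != i -> y 0 j = x 0 j by move=> /negbTE ji; rewrite mxE ji.
have yi : y 0 i = z 0 i by rewrite mxE eqxx.
have bx := pbox _ px; have bz := pbox _ pz.
have by_ : unit_box y by move=> j; rewrite mxE; case: ifP.
have gy : `|g y| <= L * h.
  rewrite -[g y]subr0 -gz; apply: Lg => // j.
  by have [->|ji] := eqVneq j i; rewrite ?yi ?subrr ?normr0// yx// xz.
have := dg x y bx by_ yx; rewrite gx subr0 yi.
have g'x : k * (3 / 4) <= `|g' x|.
  have : `|g' p - g' x| <= L * r.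
    apply: Lg' => //; [exact: ball01_unit_box|exact: ltW|].
    by move=> j; move/ball_rowE : px => /(_ r0 j)/ltW.
  by have := lerB_dist (g' p) (g' x); rewrite -/k; lra.
have u2r : `|z 0 i - x 0 i| <= 2 * r.
  move/ball_rowE : px => /(_ r0 i); move/ball_rowE : pz => /(_ r0 i).
  have := ler_distD (p 0 i) (z 0 i) (x 0 i); rewrite (distrC (z 0 i) (p 0 i)).
  lra.
rewrite (distrC (x 0 i)); set t := z 0 i - x 0 i in u2r *.
rewrite -real_normK ?num_real// => dgt.
have {dgt} : `|g' x| * `|t| <= L * `|t| ^+ 2 + L * h.
  rewrite -normrM; have := lerB_dist (g' x * t) (g y).
  by rewrite -(distrC (g y)); lra.
move: (`|t|) (normr_ge0 t) u2r => u u0 u2r ub.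
have Lu : L * u ^+ 2 <= k / 2 * u.
  by rewrite expr2 mulrA; apply: ler_wpM2r => //; nra.
have ku : k * (3 / 4) * u <= `|g' x| * u by apply: ler_wpM2r.
rewrite mulrAC ler_pdivlMr//; lra.
Qed.

(** Both terms of the difference quotient of [g] vanish, so [g' p * t] is
    bounded by [L * t ^+ 2] for small [t]. *)
Lemma partial_near_zero (R : realType) (d : nat) (L : R) (i : 'I_d)
    (g g' : 'rV[R]_d -> R) (p : 'rV[R]_d) :
    0 <= L -> partial_box L i g g' -> ball 0 1 p ->
    (\forall x \near p, g x = 0) -> g' p = 0.
Proof.
move=> L0 dg p1 /nbhs_ballP[e /= e0 ge].
have [s s0 sp] := ball_row_open ltr01 p1.
apply/eqP; apply/negPn/negP => gp.
pose k : R := `|g' p|; have k0 : 0 < k by rewrite normr_gt0.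
have L2 : 0 < L + 1 by lra.
pose t : R := Num.min (Num.min s e) (k / (L + 1)) / 2.
have m0 : 0 < Num.min (Num.min s e) (k / (L + 1)).
  by rewrite !lt_min s0 e0 divr_gt0.
have t0 : 0 < t by rewrite divr_gt0.
have tm : t < Num.min (Num.min s e) (k / (L + 1)) by rewrite /t; lra.
move: tm; rewrite !lt_min => /andP[/andP[ts te]]; rewrite ltr_pdivlMr// => tk.
pose y := \row_j (p 0 j + (j == i)%:R * t).
have ballt u : t < u -> ball p u y.
  move=> tu; apply/ball_rowE => [|j]; first exact: lt_trans tu.
  rewrite !mxE opprD addNKr normrN normrM (gtr0_norm t0).
  rewrite normr_nat; case: eqP => _; rewrite ?mul1r ?mul0r//.
  exact: lt_trans tu.
have := dg p y (ball01_unit_box p1) (ball01_unit_box (sp _ (ballt _ ts))).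
have -> : g p = 0 by apply: ge; exact: ballxx.
have -> : g y = 0 by apply: ge; exact: ballt.
rewrite subrr sub0r normrN !mxE eqxx mul1r addrAC subrr add0r.
rewrite normrM -/k (gtr0_norm t0) => dgy.
have : k * t <= L * t ^+ 2.
  by apply: dgy => j /negbTE ji; rewrite !mxE ji mul0r addr0.
by rewrite expr2 mulrA ler_pM2r//; lra.
Qed.

(** The descent step: zeros of [g] are zeros of [g'] or regular zeros of [g]. *)
Lemma thin_zeros_partial (R : realType) (d : nat) (r L : R) (i : 'I_d)
    (g g' : 'rV[R]_d -> R) :
    r <= 1 -> 0 <= L -> lipschitz_box L g -> lipschitz_box L g' ->
    partial_box L i g g' -> thin_zeros r g' -> thin_zeros r g.
Proof.
move=> r1 L0 Lg Lg' dg [null' open'].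
have d0 : (0 < d)%N by case: d i {g g' Lg Lg' dg null' open'} => [[]|].
split.
  apply: mes_zero_subset (mes_zero_bigcup2 d0
    (mes_zero_regular_zeros L0 Lg Lg' dg) null').
  move=> x [xr gx]; have [g'x|g'x] := eqVneq (g' x) 0; first by right.
  by left; split => //; exact: le_ball xr.
move=> p pr gp; apply: (open' p pr).
have p1 := le_ball r1 pr.
have [s s0 sp] := ball_row_open ltr01 p1.
have near1 : \forall x \near p, ball 0 1 x by apply/nbhs_ballP; exists s.
have gpp := near_join gp.
near=> x; apply: (partial_near_zero L0 dg); first by near: x.
by near: x.
Unshelve. all: by end_near. Qed.

Lemma thin_zeros_neq0 (R : realType) (d : nat) (L : R) (g : 'rV[R]_d -> R) :
  0 <= L -> lipschitz_box L g -> g 0 != 0 ->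
  exists2 r : R, 0 < r <= 1 & thin_zeros r g.
Proof.
move=> L0 Lg g0; pose k : R := `|g 0|.
have k0 : 0 < k by rewrite normr_gt0.
pose r : R := Num.min 1 (k / (L + 1)).
have L1 : 0 < L + 1 by lra.
have r0 : 0 < r by rewrite lt_min ltr01 divr_gt0.
have r1 : r <= 1 by rewrite ge_min lexx.
have rk : r * (L + 1) <= k by rewrite -ler_pdivlMr// /r ge_min lexx orbT.
have gn x : ball 0 r x -> g x <> 0.
  move=> xr gx.
  have : `|g 0 - g x| <= L * r.
    apply: Lg => //; [|exact: ball01_unit_box (le_ball r1 xr)|exact: ltW|].
      by move=> j; rewrite mxE normr0.
    by move=> j; move/ball_rowE : xr => /(_ r0 j)/ltW.
  by rewrite gx subr0 -/k; lra.
exists r; first by rewrite r0.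
split; first by apply: mes_zero_subset (@mes_zero0 R d) => x [/gn].
by move=> p /gn gp /nbhs_singleton.
Qed.

Definition incr (d : nat) (i : 'I_d) (b : {ffun 'I_d -> nat}) :
  {ffun 'I_d -> nat} := [ffun j => (b j + (j == i))%N].

Lemma lipschitz_box_le (R : realType) (d : nat) (L L' : R) (g : 'rV[R]_d -> R) :
  L <= L' -> lipschitz_box L g -> lipschitz_box L' g.
Proof.
move=> LL' Lg x y h bx by_ h0 xy; apply: le_trans (Lg x y h bx by_ h0 xy) _.
exact: ler_wpM2r.
Qed.

Lemma partial_box_le (R : realType) (d : nat) (L L' : R) (i : 'I_d)
    (g g' : 'rV[R]_d -> R) :
  L <= L' -> partial_box L i g g' -> partial_box L' i g g'.
Proof.
move=> LL' dg x y bx by_ xy; apply: le_trans (dg x y bx by_ xy) _.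
by apply: ler_wpM2r => //; exact: sqr_ge0.
Qed.

(** If [G b] plays the role of the derivative of multi-order [b], it suffices
    that one of them be nonzero at the origin: [G a] has no zero near the
    origin, and the descent step leads from [G a] to [G 0] along the axes. *)
Lemma thin_zeros_jet (R : realType) (d : nat)
    (G : {ffun 'I_d -> nat} -> 'rV[R]_d -> R) (a : {ffun 'I_d -> nat}) :
    (forall b, exists L : R, [/\ 0 <= L, lipschitz_box L (G b) &
       forall i, partial_box L i (G b) (G (incr i b))]) ->
    G a 0 != 0 ->
  exists2 r : R, 0 < r <= 1 & thin_zeros r (G [ffun=> 0%N]).
Proof.
move=> jet Ga; have [La [La0 LGa _]] := jet a.
have [r r01 thin_a] := thin_zeros_neq0 La0 LGa Ga.
exists r => //; have /andP[_ r1] := r01.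
suff down m : forall b : {ffun 'I_d -> nat}, (forall i, b i <= a i)%N ->
    (\sum_i (a i - b i) = m)%N -> thin_zeros r (G b).
  by apply: (down _ _ _ erefl) => i; rewrite ffunE.
elim: m => [|m IHm] b ba sum_m.
  suff -> : b = a by [].
  apply/ffunP => i; apply/eqP; rewrite eqn_leq ba/= -subn_eq0.
  by move/eqP: sum_m; rewrite sum_nat_eq0 => /forall_inP/(_ i isT).
have [i bi] : exists i, (b i < a i)%N.
  apply/existsP; apply: contra_eqT sum_m => /existsPn abE.
  rewrite big1// => i _; apply/eqP; rewrite subn_eq0 leqNgt; exact: abE.
have [L [L0 Lg dg]] := jet b; have [L' [L'0 Lg' _]] := jet (incr i b).
have LL : L <= L + L' by rewrite lerDl.
have LL' : L' <= L + L' by rewrite lerDr.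
apply: (thin_zeros_partial r1 (le_trans L0 LL) (lipschitz_box_le LL Lg)
  (lipschitz_box_le LL' Lg') (partial_box_le LL (dg i))).
apply: IHm => [j|].
  by rewrite ffunE; case: eqP => [->|_]; rewrite ?addn1 ?addn0.
apply: succn_inj; rewrite -sum_m (bigD1 i)//= [in RHS](bigD1 i)//=.
rewrite ffunE eqxx addn1 -addSn subnSK//; congr (_ + _)%N.
by apply: eq_bigr => j /negbTE ji; rewrite ffunE ji addn0.
Qed.

(** * Unconditional sums *)

#[local] Existing Instance totally_filter.

Lemma sum_uniq_subset (T : eqType) (V : nmodType) (s t : seq T) (f : T -> V) :
    uniq s -> uniq t -> {subset s <= t} ->
  \sum_(a <- t) f a = \sum_(a <- s) f a + \sum_(a <- t | a \notin s) f a.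
Proof.
move=> us ut st; rewrite (bigID (mem s))/=; congr (_ + _).
rewrite -big_filter; apply: perm_big; apply: uniq_perm => //.
  exact: filter_uniq.
by move=> a; rewrite mem_filter andb_idr//; exact: st.
Qed.

(** A finite set whose sum of norms is nearly maximal makes the net of partial
    sums Cauchy: what is added beyond it is small in norm. *)
Lemma is_cvg_totally_sum (R : realType) (T : choiceType) (u : T -> R) (B : R) :
    (forall J : {fset T}, \sum_(a <- J) `|u a| <= B) ->
  cvg ((fun J : {fset T} => \sum_(a <- J) u a) @ totally).
Proof.
move=> uB; apply/cauchy_cvgP/cauchyP => e e0.
pose S := [set \sum_(a <- J) `|u a| | J in [set: {fset T}]].
have supS : has_sup S.
  by split; [exists (\sum_(a <- fset0) `|u a|), fset0|exists B => _ [J _ <-]].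
have [_ [J0 _ <-] J0e] := sup_adherent e0 supS.
exists (\sum_(a <- J0) u a); exists J0 => // J /fsubsetP J0J.
rewrite /ball/= (sum_uniq_subset _ (fset_uniq J0) (fset_uniq J) J0J).
rewrite opprD addrA subrr sub0r normrN.
apply: le_lt_trans (ler_norm_sum _ _ _) _.
have := sum_uniq_subset (fun a => `|u a|) (fset_uniq J0) (fset_uniq J) J0J.
have : \sum_(a <- J) `|u a| <= sup S.
  by apply: sup_upper_bound => //; exists J.
by move: J0e; lra.
Qed.

Lemma totally_sum_norm_le (R : realType) (T : choiceType) (u : T -> R)
    (B l : R) :
    (forall J : {fset T}, `|\sum_(a <- J) u a| <= B) ->
    (fun J : {fset T} => \sum_(a <- J) u a) @ totally --> l ->
  `|l| <= B.
Proof.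
move=> uB /cvg_norm ul; rewrite -(cvg_lim _ ul)//.
by apply: limr_le; [apply/cvg_ex; exists (`|l|)|exact: nearW].
Qed.

Lemma sum_geo_half (R : realType) (n : nat) :
  \sum_(k < n) (1 / 2 : R) ^+ k <= 2.
Proof.
suff -> : \sum_(k < n) (1 / 2 : R) ^+ k = 2 - 2 * (1 / 2) ^+ n.
  by rewrite gerBl mulr_ge0// exprn_ge0//; lra.
elim: n => [|n IHn]; first by rewrite big_ord0 expr0; lra.
by rewrite big_ord_recr/= IHn exprS; lra.
Qed.

(** A finite set of multi-indices lies in a cube, over which the sum factors
    into [d] geometric sums, each at most 2. *)
Lemma sum_multi_geo_half (R : realType) (d : nat)
    (J : {fset {ffun 'I_d -> nat}}) :
  \sum_(a <- J) \prod_i (1 / 2 : R) ^+ a i <= 2 ^+ d.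
Proof.
pose f (a : {ffun 'I_d -> nat}) := \prod_i (1 / 2 : R) ^+ a i.
have f0 a : 0 <= f a by apply: prodr_ge0 => i _; rewrite exprn_ge0//; lra.
pose N := (\sum_(a <- J) \sum_i a i).+1.
have JN a i : a \in J -> (a i < N)%N.
  move=> aJ; rewrite ltnS (big_fsetD1 a)//= (bigD1 i)//= -addnA.
  exact: leq_addr.
pose emb (g : {ffun 'I_d -> 'I_N}) : {ffun 'I_d -> nat} :=
  [ffun i => val (g i)].
pose t := [seq emb g | g in {ffun 'I_d -> 'I_N}].
have emb_inj : injective emb.
  move=> g h /ffunP gh; apply/ffunP => i; apply: val_inj.
  by have := gh i; rewrite !ffunE.
have ut : uniq t by rewrite map_inj_uniq ?enum_uniq.
have Jt : {subset J <= t}.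
  move=> a aJ; apply/mapP; exists [ffun i => Ordinal (JN a i aJ)].
    by rewrite mem_enum.
  by apply/ffunP => i; rewrite !ffunE.
apply: (@le_trans _ _ (\sum_(a <- t) f a)).
  by rewrite (sum_uniq_subset f (fset_uniq J) ut Jt) lerDl sumr_ge0.
rewrite big_map big_enum/= /f.
under eq_bigr do under eq_bigr do rewrite ffunE.
rewrite -(bigA_distr_bigA (fun (i : 'I_d) (k : 'I_N) => (1 / 2 : R) ^+ k)).
rewrite prodr_const card_ord lerXn2r// ?nnegrE//; last exact: sum_geo_half.
by apply: sumr_ge0 => k _; rewrite exprn_ge0//; lra.
Qed.

(** Outside some finite [J0], adding an index to [J0] moves the partial sum by
    less than 2. *)
Lemma totally_sum_terms_bounded (R : realType) (T : choiceType) (u : T -> R)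
    (l : R) :
  (fun J : {fset T} => \sum_(a <- J) u a) @ totally --> l ->
  exists M, forall a, `|u a| <= M.
Proof.
move=> /cvgrPdist_lt/(_ 1 ltr01)[J0 _ J0l].
exists (2 + \sum_(a <- J0) `|u a|) => a.
have s0 (J : {fset T}) : 0 <= \sum_(b <- J) `|u b| by exact: sumr_ge0.
have [aJ|aJ] := boolP (a \in J0).
  rewrite (big_fsetD1 a aJ)/=.
  by have := s0 (J0 `\ a)%fset; lra.
have l0 := J0l J0 (fsubset_refl _).
have := J0l (a |` J0)%fset (fsubsetU1 _ _); rewrite /= big_fsetU1//=.
move: l0; rewrite /=; set S := \sum_(b <- J0) u b => l0 l1.
have -> : u a = (l - S) - (l - (u a + S)) by ring.
by have := ler_normB (l - S) (l - (u a + S)); have := s0 J0; lra.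
Qed.

(** * Derivatives of monomials *)

Lemma pow_norm_le1 (R : realType) (n : nat) (x : R) :
  `|x| <= 1 -> `|x ^+ n| <= 1.
Proof. by move=> x1; rewrite normrX exprn_ile1. Qed.

Lemma pow_lipschitz (R : realType) (n : nat) (x y : R) :
  `|x| <= 1 -> `|y| <= 1 -> `|y ^+ n - x ^+ n| <= n%:R * `|y - x|.
Proof.
move=> x1 y1; elim: n => [|n IHn]; first by rewrite subrr normr0 mul0r.
have -> : y ^+ n.+1 - x ^+ n.+1 = y * (y ^+ n - x ^+ n) + (y - x) * x ^+ n.
  by rewrite !exprS; ring.
apply: le_trans (ler_normD _ _) _; rewrite !normrM -natr1 mulrDl mul1r.
apply: lerD; first by apply: le_trans IHn; rewrite ler_piMl.
by rewrite ler_piMr// pow_norm_le1.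
Qed.

Lemma pow_taylor (R : realType) (n : nat) (x y : R) :
    `|x| <= 1 -> `|y| <= 1 ->
  `|y ^+ n - x ^+ n - n%:R * x ^+ n.-1 * (y - x)|
    <= (n * n.-1)%:R * (y - x) ^+ 2.
Proof.
move=> x1 y1; case: n => [|n]; first by rewrite subrr !mul0r subr0 normr0.
elim: n => [|n IHn].
  by rewrite muln0 !expr1 expr0 !mul1r subrr normr0 mul0r.
have -> : y ^+ n.+2 - x ^+ n.+2 - n.+2%:R * x ^+ n.+1 * (y - x) =
    y * (y ^+ n.+1 - x ^+ n.+1 - n.+1%:R * x ^+ n * (y - x)) +
    n.+1%:R * x ^+ n * (y - x) ^+ 2.
  by rewrite !exprS -[n.+2]add1n -[n.+1]add1n !natrD; ring.
apply: le_trans (ler_normD _ _) _.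
rewrite [X in X + _ <= _]normrM [X in _ + X <= _]normrM (ger0_norm (sqr_ge0 _)).
rewrite [X in _ + X * _ <= _]normrM normr_nat /=.
apply: (@le_trans _ _ ((n.+1 * n)%:R * (y - x) ^+ 2 + n.+1%:R * (y - x) ^+ 2)).
  apply: lerD; first by apply: le_trans IHn; rewrite ler_piMl.
  by rewrite ler_wpM2r ?sqr_ge0// ler_piMr// pow_norm_le1.
rewrite -mulrDl -natrD ler_wpM2r ?sqr_ge0// ler_nat /=; nia.
Qed.

(** The derivative of order [b] of the monomial [X ^ n].  The falling factorial
    vanishes when [n < b], so the truncated exponent is harmless. *)
Definition fpow (R : realType) (n b : nat) (x : R) : R :=
  (n ^_ b)%:R * x ^+ (n - b).

(** A common bound for [n ^_ b], [n ^_ b.+1] and [n ^_ b.+2], which control the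
    values, the slopes and the Taylor remainders of [fpow n b].  Its growth in
    [n] is geometric, so it can be absorbed by the decay of the coefficients. *)
Definition fpow_bound (n b : nat) : nat := ((b.+2)`! * 2 ^ n)%N.

Lemma bin_le_exp2 (n m : nat) : ('C(n, m) <= 2 ^ n)%N.
Proof.
elim: n m => [|n IHn] [|m] //; first by rewrite bin0 expn_gt0.
by rewrite binS expnS mul2n -addnn leq_add.
Qed.

Lemma ffact_le_bound (n b k : nat) :
  (k <= b.+2)%N -> (n ^_ k <= fpow_bound n b)%N.
Proof.
by move=> kb; rewrite -bin_ffact mulnC leq_mul ?leq_fact ?bin_le_exp2.
Qed.

Section Fpow.
Variables (R : realType) (n b : nat) (x y : R).
Hypotheses (x1 : `|x| <= 1) (y1 : `|y| <= 1).

Lemma fpow_le : `|fpow n b x| <= (fpow_bound n b)%:R.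
Proof.
rewrite normrM normr_nat -[leRHS]mulr1 ler_pM// ?pow_norm_le1//.
by rewrite ler_nat ffact_le_bound// ltnW.
Qed.

Lemma fpow_lipschitz :
  `|fpow n b y - fpow n b x| <= (fpow_bound n b)%:R * `|y - x|.
Proof.
rewrite -mulrBr normrM normr_nat.
apply: le_trans (ler_wpM2l _ (pow_lipschitz _ x1 y1)) _ => //.
rewrite mulrA -natrM -ffactnSr ler_wpM2r// ler_nat.
by rewrite ffact_le_bound.
Qed.

Lemma fpow_taylor :
  `|fpow n b y - fpow n b x - fpow n b.+1 x * (y - x)|
    <= (fpow_bound n b)%:R * (y - x) ^+ 2.
Proof.
rewrite /fpow ffactnSr natrM subnS -!mulrA -mulrBr -mulrBr normrM normr_nat.
rewrite [X in `|_ - X|]mulrA.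
apply: le_trans (ler_wpM2l _ (pow_taylor _ x1 y1)) _ => //.
rewrite mulrA -natrM mulnA -subnS -!ffactnSr ler_wpM2r ?sqr_ge0// ler_nat.
by rewrite ffact_le_bound.
Qed.

End Fpow.

Lemma prod_lipschitz (R : realType) (T : Type) (s : seq T) (p q V : T -> R)
    (h : R) : 0 <= h ->
    (forall i, `|p i| <= V i) -> (forall i, `|q i| <= V i) ->
    (forall i, `|p i - q i| <= V i * h) ->
  `|\prod_(i <- s) p i - \prod_(i <- s) q i|
    <= (size s)%:R * (\prod_(i <- s) V i) * h.
Proof.
move=> h0 pV qV pq; have V0 i : 0 <= V i by apply: le_trans (pV i).
elim: s => [|i s IHs]; first by rewrite !big_nil subrr normr0 !mul0r.
rewrite !big_cons /=; set P := \prod_(i <- s) p i; set Q := \prod_(i <- s) q i.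
have -> : p i * P - q i * Q = p i * (P - Q) + (p i - q i) * Q by ring.
apply: le_trans (ler_normD _ _) _; rewrite !normrM.
have W0 : 0 <= \prod_(i <- s) V i by exact: prodr_ge0.
have QW : `|Q| <= \prod_(i <- s) V i.
  by rewrite normr_prod; apply: ler_prod => j _; rewrite normr_ge0 qV.
apply: (@le_trans _ _ (V i * ((size s)%:R * \prod_(i <- s) V i * h) +
    V i * h * \prod_(i <- s) V i)).
  by apply: lerD; apply: ler_pM => //; exact: IHs.
by rewrite -natr1 le_eqVlt; apply/orP; left; apply/eqP; ring.
Qed.

(** * Power series and their formal derivatives *)

Section JetTerm.
Variables (R : realType) (d : nat) (c : {ffun 'I_d -> nat} -> R).
Implicit Types (a b : {ffun 'I_d -> nat}) (x y : 'rV[R]_d).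

(** The term of index [a] of the series differentiated [b] times.  Indexing by
    the original multi-index [a] spares the shift of the summation index that
    differentiation causes. *)
Definition jet_term b a x : R := c a * \prod_i fpow (a i) (b i) (x 0 i).

Definition jet_term_bound b a : R :=
  `|c a| * \prod_i (fpow_bound (a i) (b i))%:R.

Lemma jet_term_le b a x : unit_box x -> `|jet_term b a x| <= jet_term_bound b a.
Proof.
move=> bx; rewrite normrM ler_wpM2l// normr_prod.
by apply: ler_prod => i _; rewrite normr_ge0 fpow_le.
Qed.

Lemma jet_term_lipschitz b a x y h : unit_box x -> unit_box y -> 0 <= h ->
    (forall j, `|x 0 j - y 0 j| <= h) ->
  `|jet_term b a x - jet_term b a y| <= jet_term_bound b a * (d%:R * h).
Proof.
move=> bx by_ h0 xy; rewrite -mulrBr normrM /jet_term_bound -mulrA ler_wpM2l//.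
have -> : d%:R = (size (index_enum 'I_d))%:R :> R.
  by rewrite -[in LHS](card_ord d) cardT enumT.
rewrite mulrCA mulrA; apply: prod_lipschitz => // i; try exact: fpow_le.
by apply: le_trans (fpow_lipschitz _ _ (by_ i) (bx i)) _; rewrite ler_wpM2l.
Qed.

Lemma jet_term_partial b a i x y : unit_box x -> unit_box y ->
    (forall j, j != i -> y 0 j = x 0 j) ->
  `|jet_term b a y - jet_term b a x - jet_term (incr i b) a x * (y 0 i - x 0 i)|
    <= jet_term_bound b a * (y 0 i - x 0 i) ^+ 2.
Proof.
move=> bx by_ yx; rewrite /jet_term /jet_term_bound.
rewrite (bigD1 i)//= [in X in _ - X - _](bigD1 i)//=.
rewrite [in X in _ - X](bigD1 i)//=.
rewrite [in leRHS](bigD1 i)//= /incr ffunE eqxx addn1.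
set P := \prod_(j | j != i) fpow _ _ (x 0 j).
rewrite (eq_bigr (fun j => fpow (a j) (b j) (x 0 j))); last first.
  by move=> j ji; rewrite yx.
rewrite [X in _ - _ * (_ * X) * _](eq_bigr
  (fun j => fpow (a j) (b j) (x 0 j))); last first.
  by move=> j /negbTE ji; rewrite ffunE ji addn0.
rewrite -/P.
set t := y 0 i - x 0 i; set w := fpow _ _ (y 0 i).
set v := fpow _ _ (x 0 i); set v' := fpow _ _.+1 _.
have -> : c a * (w * P) - c a * (v * P) - c a * (v' * P) * t =
  c a * (P * (w - v - v' * t)) by ring.
rewrite normrM -[leRHS]mulrA ler_wpM2l// normrM.
rewrite [leRHS]mulrAC [leRHS]mulrC ler_pM//.
  by rewrite normr_prod; apply: ler_prod => j _; rewrite normr_ge0 fpow_le.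
exact: fpow_taylor.
Qed.

Lemma fpow0 n k : n != k -> fpow n k (0 : R) = 0.
Proof.
rewrite neq_ltn /fpow => /orP[nk|kn]; first by rewrite ffact_small// mul0r.
by rewrite expr0n subn_eq0 leqNgt kn mulr0.
Qed.

Lemma jet_term0 b a : a != b -> jet_term b a 0 = 0.
Proof.
move=> ab; have [i abi] : exists i, a i != b i.
  apply/existsP; apply: contraNT ab => /existsPn abE.
  by apply/eqP/ffunP => i; apply/eqP; have := abE i; rewrite negbK.
by rewrite /jet_term (bigD1 i)//= mxE fpow0// mul0r mulr0.
Qed.

Lemma jet_term0_neq0 b : c b != 0 -> jet_term b b 0 != 0.
Proof.
move=> cb; rewrite mulf_neq0//; apply/prodf_neq0 => i _.
rewrite /fpow subnn expr0 mulr1 pnatr_eq0 -lt0n.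
by rewrite ffactnn fact_gt0.
Qed.

Lemma jet_term_monomial a x :
  jet_term [ffun=> 0%N] a x = c a * monomial a x.
Proof.
congr (_ * _); apply: eq_bigr => i _.
by rewrite /fpow ffunE ffactn0 mul1r subn0.
Qed.

Variable M : R.
(* The ratio 1/4 against the growth [2 ^ n] of [fpow_bound] leaves a geometric
   series of ratio 1/2. *)
Hypothesis c_le : forall a, `|c a| <= M * \prod_i (1 / 4) ^+ a i.

Definition jet_const b : R := M * (\prod_i ((b i).+2)`!%:R) * 2 ^+ d.

Lemma coef_bound_ge0 : 0 <= M.
Proof.
have := c_le [ffun=> 0%N]; rewrite big1 ?mulr1; first exact: le_trans.
by move=> i _; rewrite ffunE.
Qed.

Lemma sum_jet_term_bound b (J : {fset {ffun 'I_d -> nat}}) :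
  \sum_(a <- J) jet_term_bound b a <= jet_const b.
Proof.
have M0 := coef_bound_ge0.
have K0 : 0 <= M * \prod_i ((b i).+2)`!%:R by rewrite mulr_ge0// prodr_ge0.
apply: le_trans (ler_wpM2l K0 (sum_multi_geo_half R J)).
rewrite mulr_sumr; apply: ler_sum => a _.
apply: (@le_trans _ _ (M * \prod_i (1 / 4) ^+ a i *
    \prod_i (fpow_bound (a i) (b i))%:R)).
  by rewrite ler_wpM2r// prodr_ge0.
rewrite -!mulrA -!big_split/= ler_wpM2l// le_eqVlt; apply/orP; left; apply/eqP.
apply: eq_bigr => i _; rewrite /fpow_bound natrM natrX mulrCA -exprMn.
by congr (_ * _ ^+ _); lra.
Qed.

Definition jet_sum b x : R :=
  lim ((fun J : {fset {ffun 'I_d -> nat}} => \sum_(a <- J) jet_term b a x)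
    @ totally).

Lemma jet_sum_cvg b x : unit_box x ->
  (fun J : {fset {ffun 'I_d -> nat}} => \sum_(a <- J) jet_term b a x) @ totally
    --> jet_sum b x.
Proof.
move=> bx; apply: (is_cvg_totally_sum (B := jet_const b)) => J.
apply: le_trans (sum_jet_term_bound b J).
by apply: ler_sum => a _; exact: jet_term_le.
Qed.

(** Termwise estimates relative to [jet_term_bound] pass to the sum of the
    series, since they are uniform over its finite partial sums. *)
Lemma jet_sum_norm_le b (u : {ffun 'I_d -> nat} -> R) l k : 0 <= k ->
    (forall a, `|u a| <= jet_term_bound b a * k) ->
    (fun J : {fset {ffun 'I_d -> nat}} => \sum_(a <- J) u a) @ totally --> l ->
  `|l| <= jet_const b * k.
Proof.
move=> k0 uk; apply: totally_sum_norm_le => J.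
apply: le_trans (ler_norm_sum _ _ _) _.
apply: (@le_trans _ _ (\sum_(a <- J) jet_term_bound b a * k)).
  exact: ler_sum.
by rewrite -mulr_suml ler_wpM2r// sum_jet_term_bound.
Qed.

Lemma jet_sum_lipschitz b : lipschitz_box (jet_const b * d%:R) (jet_sum b).
Proof.
move=> x y h bx by_ h0 xy; rewrite -mulrA.
apply: (@jet_sum_norm_le b (fun a => jet_term b a x - jet_term b a y)).
- exact: mulr_ge0.
- by move=> a; exact: jet_term_lipschitz.
- rewrite (_ : (fun J => _) = (fun J : {fset {ffun 'I_d -> nat}} =>
      \sum_(a <- J) jet_term b a x -
      \sum_(a <- J) jet_term b a y)); last by apply/funext => J; rewrite sumrB.
  by apply: cvgB; [exact: jet_sum_cvg bx|exact: jet_sum_cvg by_].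
Qed.

Lemma jet_sum_partial b i :
  partial_box (jet_const b) i (jet_sum b) (jet_sum (incr i b)).
Proof.
move=> x y bx by_ yx.
apply: (@jet_sum_norm_le b (fun a => jet_term b a y - jet_term b a x -
  jet_term (incr i b) a x * (y 0 i - x 0 i))).
- exact: sqr_ge0.
- by move=> a; exact: jet_term_partial.
- rewrite (_ : (fun J => _) = (fun J : {fset {ffun 'I_d -> nat}} =>
      \sum_(a <- J) jet_term b a y -
      \sum_(a <- J) jet_term b a x -
      (\sum_(a <- J) jet_term (incr i b) a x) * (y 0 i - x 0 i))); last first.
    by apply/funext => J; rewrite !sumrB -mulr_suml.
  apply: cvgB; last by apply: cvgMr_tmp; exact: jet_sum_cvg.
  by apply: cvgB; [exact: jet_sum_cvg by_|exact: jet_sum_cvg bx].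
Qed.

(** At the origin only the term of index [b] survives, with value [c b] times
    the product of the factorials of the [b i]. *)
Lemma jet_sum0_neq0 b : c b != 0 -> jet_sum b 0 != 0.
Proof.
move=> cb; suff -> : jet_sum b 0 = jet_term b b 0 by exact: jet_term0_neq0.
apply: cvg_lim => //; apply: cvg_near_cst; exists [fset b]%fset => // J /=.
rewrite fsub1set => bJ; rewrite (big_fsetD1 b)//= big_seq big1 ?addr0// => a.
by rewrite !inE => /andP[ab _]; rewrite jet_term0.
Qed.

Lemma thin_zeros_jet_sum a : c a != 0 ->
  exists2 r : R, 0 < r <= 1 & thin_zeros r (jet_sum [ffun=> 0%N]).
Proof.
move=> ca; apply: thin_zeros_jet (jet_sum0_neq0 ca) => b.
have C0 : 0 <= jet_const b by rewrite !mulr_ge0 ?coef_bound_ge0 ?prodr_ge0.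
exists (jet_const b * d.+1%:R); split; first by rewrite mulr_ge0.
  by apply: lipschitz_box_le (jet_sum_lipschitz b); rewrite ler_wpM2l ?ler_nat.
move=> i; apply: (@partial_box_le _ _ (jet_const b)).
  by rewrite ler_peMr// ler1n.
exact: jet_sum_partial.
Qed.

End JetTerm.

(** * Zeros of analytic functions *)

(** A local dichotomy: a power series with no nonzero coefficient sums to 0, and
    any other one has a thin zero set near its center. *)
Lemma analytic_thin_zeros (R : realType) (d : nat) (f : 'rV[R]_d -> R)
    (p : 'rV[R]_d) : (0 < d)%N -> real_analytic_at f p ->
  (\forall x \near p, f x = 0) \/
  exists r : R, [/\ 0 < r, mes_zero [set x | ball p r x /\ f x = 0] &
    forall q, ball p r q -> ~ (\forall x \near q, f x = 0)].
Proof.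
move=> d0 [c /nbhs_ballP[e /= e0 ce]].
have [c0|/existsNP[a ca]] := pselect (forall a, c a = 0).
  left; apply/nbhs_ballP; exists e => //= x px.
  have fx := ce x px; apply: (cvg_unique _ fx) => //.
  apply: cvg_near_cst; apply: nearW => J; rewrite big1// => a _.
  by rewrite c0 mul0r.
right.
have px1 : ball p e (p + const_mx (e / 2)).
  apply/ball_rowE => // i; rewrite !mxE opprD addNKr normrN gtr0_norm; lra.
have [M cM] := totally_sum_terms_bounded (ce _ px1).
have {}cM b : `|c b * \prod_i (e / 2) ^+ b i| <= M.
  apply: le_trans (cM b); rewrite addrC addKr /monomial.
  by under [in leRHS]eq_bigr do rewrite mxE.
(* The terms are bounded at [p + (e / 2, ..., e / 2)]; the scale [e / 8] gains
   the factor [(1 / 4) ^+ b i] in each coordinate. *)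
pose s : R := e / 8; have s0 : 0 < s by rewrite divr_gt0.
pose c' b := c b * \prod_i s ^+ b i.
have c'M b : `|c' b| <= M * \prod_i (1 / 4) ^+ b i.
  have -> : c' b = c b * (\prod_i (e / 2) ^+ b i) * \prod_i (1 / 4) ^+ b i.
    rewrite -mulrA -big_split/=; congr (_ * _); apply: eq_bigr => i _.
    by rewrite -exprMn; congr (_ ^+ _); rewrite /s; lra.
  have g0 : 0 <= \prod_i (1 / 4 : R) ^+ b i.
    by apply: prodr_ge0 => i _; rewrite exprn_ge0//; lra.
  by rewrite normrM (ger0_norm g0) ler_wpM2r.
have c'a : c' a != 0.
  rewrite mulf_neq0//; first exact/eqP.
  by apply/prodf_neq0 => i _; rewrite expf_neq0// gt_eqF.
have [r /andP[r0 r1] [null nopen]] := thin_zeros_jet_sum c'M c'a.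
have fE z : unit_box z -> jet_sum c' [ffun=> 0%N] z = f (p + s *: z).
  move=> bz; apply: cvg_lim => //.
  have pz : ball p e (p + s *: z).
    apply/ball_rowE => // i.
    rewrite !mxE opprD addNKr normrN normrM gtr0_norm//.
    have := bz i; have : s * `|z 0 i| <= s * 1 by rewrite ler_pM2l.
    by rewrite /s; lra.
  apply: cvg_trans (ce _ pz); apply: near_eq_cvg; apply: nearW => J.
  apply: eq_bigr => b _; rewrite jet_term_monomial /c' -mulrA; congr (_ * _).
  rewrite addrC addKr /monomial -big_split/=.
  by apply: eq_bigr => i _; rewrite mxE exprMn.
have sr0 : 0 < s * r by exact: mulr_gt0.
pose zoom x : 'rV[R]_d := s^-1 *: (x - p).
have zoomK x : p + s *: zoom x = x.
  by rewrite scalerA mulfV ?gt_eqF// scale1r addrC subrK.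
have ball_zoom x : ball p (s * r) x -> ball 0 r (zoom x).
  move=> /ball_rowE -/(_ sr0) px; apply/ball_rowE => // i.
  rewrite !mxE sub0r normrN normrM gtr0_norm ?invr_gt0// mulrC.
  by rewrite ltr_pdivrMr// mulrC distrC.
have boxr z : ball 0 r z -> unit_box z by move=> /(le_ball r1)/ball01_unit_box.
exists (s * r); split => //.
  apply: mes_zero_subset (mes_zero_affine p d0 s0 null) => x [px fx].
  exists (zoom x); last exact: zoomK.
  split; first exact: ball_zoom.
  by rewrite fE ?zoomK//; exact/boxr/ball_zoom.
move=> q /ball_zoom qr /nbhs_ballP[t /= t0 ft]; apply: (nopen _ qr).
have [v v0 qv] := ball_row_open r0 qr.
have ts0 : 0 < t / s by rewrite divr_gt0.
apply/nbhs_ballP; exists (Num.min v (t / s)); first by rewrite /= lt_min v0.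
move=> z qz; have bz : unit_box z.
  apply/boxr/qv; apply: le_ball qz; by rewrite ge_min lexx.
rewrite /= fE//; apply: ft; rewrite -(zoomK q).
have {qz}/ball_rowE -/(_ ts0) qz : ball (zoom q) (t / s) z.
  by apply: le_ball qz; rewrite ge_min lexx orbT.
apply/ball_rowE => // i; have := qz i; rewrite ltr_pdivlMr//.
apply: le_lt_trans; move: (zoom q) => w.
rewrite !mxE opprD addrACA subrr add0r -mulrBr normrM gtr0_norm//.
by rewrite mulrC.
Qed.

Theorem proposition1 (R : realType) (d : nat) (hd : (1 <= d)%N)
    (U : set 'rV[R]_d) (U_open : open U) (U_connected : connected U)
    (A : 'rV[R]_d -> R) (A_analytic : real_analytic_on U A)
    (A_neq0 : ~ (forall x, U x -> A x = 0)) :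
  mes_zero [set x | U x /\ A x = 0].
Proof.
pose Z := [set x | A x = 0]; pose B := U `&` Z°.
(* [B] is relatively closed in [U]: at a point of its closure the zeros of [A]
   are not thin, so the dichotomy puts that point in [B]. *)
have B0 p : ~ B p.
  move=> Bp; apply: A_neq0; suff <- : B = U by move=> x [_ /interior_subset].
  apply: U_connected; first by exists p.
    by exists Z° => //; exact: open_interior.
  exists (closure B); first exact: closed_closure.
  apply/seteqP; split=> [x Bx|x [Ux clBx]].
    by split; [case: Bx|exact: subset_closure].
  split => //.
  have [//|[r [r0 _ nr]]] := analytic_thin_zeros hd (A_analytic x Ux).
  have [q [[_ Zq] xq]] := clBx _ (nbhsx_ballx x r r0).
  by case: (nr q xq).
apply: mes_zero_local => // p [Up Ap].
have [Zp|[r [r0 null _]]] := analytic_thin_zeros hd (A_analytic p Up).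
  by case: (B0 p).
exists r => //; apply: mes_zero_subset null.
by move=> x [[Ux Ax] px].
Qed.
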